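(* Let $\mathscr{H}$ be a real Hilbert space, let $A:\mathscr{H}\to 2^{\mathscr{H}}$ be maximal monotone, let $B:\mathscr{H}\to\mathscr{H}$ be monotone and $L$-Lipschitz continuous for some $L>0$, and suppose that $\Omega:=(A+B)^{-1}(\mathbf{0})=\{x\in\mathscr{H}:\mathbf{0}\in A(x)+B(x)\}$ is nonempty. Let $0<\alpha<\tfrac13$, let $\beta\in\left[0,\frac{1-3\alpha}{3(1-\alpha)}\right)$, and let $\{\theta_n\}_{n\ge1}$ be a real sequence with $0\le\theta_n\le\theta_{n+1}\le1$ for all $n\ge 1$. If in addition $A$ is $\nu$-strongly monotone for some $\nu>0$, then any sequence $\{x_n\}$ generated by Algorithm IPCMAS1 (described in the context) converges strongly (in norm) to the unique point of $\Omega$.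
   Context: A set-valued operator $A:\mathscr{H}\to2^{\mathscr{H}}$ is $\nu$-strongly monotone ($\nu>0$) if $\langle u-v,x-y\rangle\ge\nu\|x-y\|^2$ for all $x,y\in\mathscr{H}$, $u\in A(x)$, $v\in A(y)$. For $\lambda>0$, the resolvent of a maximal monotone operator $A$ is the single-valued map $J^A_\lambda:=(I+\lambda A)^{-1}:\mathscr{H}\to\mathscr{H}$. Algorithm IPCMAS1. Choose $\mu\in(0,1)$, $\gamma\in(0,2)$, $\lambda_1>0$, a nonnegative real sequence $\{\xi_n\}_{n\ge1}$ with $\sum_{n=1}^\infty\xi_n<+\infty$, and starting points $x_0,x_1\in\mathscr{H}$ (all arbitrary subject to these constraints). For $n=1,2,\dots$ compute $$z_n=x_n+\beta(x_n-x_{n-1}),\qquad w_n=x_n+\theta_n(x_n-x_{n-1}),\qquad y_n=J^A_{\lambda_n}\big(w_n-\lambda_nB(w_n)\big).$$ If $y_n=w_n$, stop ($y_n$ is a solution). Otherwise set $$d_n=w_n-y_n-\lambda_n\big(B(w_n)-B(y_n)\big),\qquad \eta_n=\begin{cases}\dfrac{\langle w_n-y_n,d_n\rangle}{\|d_n\|^2},&d_n\neq0,\\ 0,&d_n=0,\end{cases}$$ $$u_n=w_n-\gamma\eta_nd_n,\qquad x_{n+1}=(1-\alpha)z_n+\alpha u_n,$$ and update $$\lambda_{n+1}=\begin{cases}\min\left\{\dfrac{\mu\|w_n-y_n\|}{\|B(w_n)-B(y_n)\|},\ \lambda_n+\xi_n\right\},&B(w_n)\neq B(y_n),\\ \lambda_n+\xi_n,&\text{otherwise.}\end{cases}$$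 Statements about the generated sequence $\{x_n\}$ concern infinite runs, i.e. the case in which the algorithm never stops ($y_n\ne w_n$ for all $n\ge1$). *)

(* Defs.v *)
From HB Require Import structures.
From mathcomp Require Export all_boot all_order all_algebra.
From mathcomp Require Export sesquilinear.
From mathcomp Require Export all_classical all_reals all_analysis.
Export Order.TTheory GRing.Theory Num.Theory.
Export numFieldNormedType.Exports.

Set Implicit Arguments.
Unset Strict Implicit.
Unset Printing Implicit Defensive.

Local Open Scope classical_set_scope.
Local Open Scope ring_scope.

Section Operators.
Context {R : realType} {H : completeNormedModType R}.
Implicit Types (ip : {dot H for idfun}) (A : H -> set H) (B : H -> H).

(* The Hilbert structure: [ip] is a symmetric positive definite bilinear form
   and H is complete for the norm that it induces. *)
Definition induces_norm ip := forall x : H, `|x| ^+ 2 = ip x x.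

Definition strongly_monotone ip (nu : R) A :=
  forall x y u v : H, A x u -> A y v ->
    nu * `|x - y| ^+ 2 <= ip (u - v) (x - y).

Definition monotone_op ip A :=
  forall x y u v : H, A x u -> A y v -> 0 <= ip (u - v) (x - y).

(* The graph of A is not properly contained in that of a monotone operator. *)
Definition maximal_monotone ip A :=
  monotone_op ip A /\
  forall A1 : H -> set H,
    monotone_op ip A1 -> (forall x, A x `<=` A1 x) -> A1 = A.

Definition op_inv A (u : H) : set H := [set x | A x u].

Definition zeros_sum A B : set H :=
  op_inv (fun x => [set u + B x | u in A x]) 0.

(* (I + lambda A)^-1 as a set-valued inverse, so that [resolvent A lambda x y]
   reads y = J^A_lambda(x): the value is unique by [resolvent_inj]. *)
Definition resolvent A (lambda : R) : H -> set H :=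
  op_inv (fun y => [set y + lambda *: u | u in A y]).

Lemma resolvent_inj ip A (lambda : R) (x y1 y2 : H) :
  monotone_op ip A -> 0 < lambda ->
  resolvent A lambda x y1 -> resolvent A lambda x y2 -> y1 = y2.
Proof.
move=> monA l0 [u1 Au1 <-] [u2 Au2] /eqP.
rewrite -subr_eq0 opprD addrACA -scalerBr addr_eq0 => /eqP E.
have := monA _ _ _ _ Au2 Au1.
rewrite E -scaleNr linearZr /= mulNr oppr_ge0.
rewrite pmulr_rle0// => le0.
have [/eqP e0|/neq0_dnorm_gt0/lt_le_trans/(_ le0)] := eqVneq (u2 - u1) 0.
  by move: E; rewrite (eqP e0) scaler0 oppr0 => /eqP; rewrite subr_eq0 => /eqP.
by rewrite ltxx.
Qed.

End Operators.

(* Only [x] is used at index 0. *)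
Record IPCMAS1_run (R : realType) (H : completeNormedModType R)
    (ip : {dot H for idfun}) (A : H -> set H) (B : H -> H)
    (alpha beta mu gamma : R) (theta xi : nat -> R)
    (x z w y d u : nat -> H) (eta lambda : nat -> R) : Prop := {
  mu_range : 0 < mu < 1;
  gamma_range : 0 < gamma < 2;
  lambda1_gt0 : 0 < lambda 1%N;
  xi_ge0 : forall n, (1 <= n)%N -> 0 <= xi n;
  xi_summable : (\sum_(1 <= n <oo) (xi n)%:E < +oo)%E;
  z_def : forall n, (1 <= n)%N -> z n = x n + beta *: (x n - x n.-1);
  w_def : forall n, (1 <= n)%N -> w n = x n + theta n *: (x n - x n.-1);
  y_def : forall n, (1 <= n)%N ->
    resolvent A (lambda n) (w n - lambda n *: B (w n)) (y n);
  never_stops : forall n, (1 <= n)%N -> y n <> w n;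
  d_def : forall n, (1 <= n)%N ->
    d n = w n - y n - lambda n *: (B (w n) - B (y n));
  eta_def : forall n, (1 <= n)%N ->
    eta n = if d n != 0 then ip (w n - y n) (d n) / `|d n| ^+ 2 else 0;
  u_def : forall n, (1 <= n)%N -> u n = w n - (gamma * eta n) *: d n;
  x_def : forall n, (1 <= n)%N -> x n.+1 = (1 - alpha) *: z n + alpha *: u n;
  lambda_def : forall n, (1 <= n)%N ->
    lambda n.+1 =
      if B (w n) != B (y n)
      then Num.min (mu * `|w n - y n| / `|B (w n) - B (y n)|) (lambda n + xi n)
      else lambda n + xi n
}.

(* Main.v *)
(* Fejer-type descent: [d n] is [lambda n] times an element of
   [A (y n) + B (y n)], so monotonicity of [B] and strong monotonicity of [A] give
   [|u n - p|^2 <= |w n - p|^2 - c (|w n - y n|^2 + |y n - p|^2)] as soon as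
   [lambda n |B (w n) - B (y n)| <= kappa |w n - y n|] with [kappa < 1]; this
   holds eventually because [lambda] is bounded below and its increments are
   dominated by a summable sequence.  Inserting this in the inertial recursion,
   the conditions on [alpha] and [beta] make
   [|x n.+1 - p|^2 - tau n |x n - p|^2 + K |x n.+1 - x n|^2] a nonincreasing
   Lyapunov function, so its decrements vanish: [|x n.+1 - x n|], [|w n - y n|]
   and, by strong monotonicity, [|y n - p|] tend to 0, hence [x] tends to [p]. *)
Require Import Defs.
From mathcomp Require Import ring lra.
Local Open Scope classical_set_scope.
Local Open Scope ring_scope.

(** * Convergence of real sequences governed by decreasing quantities *)

Section RealSequences.
Context {R : realType}.
Implicit Types a D q G e lam xi tau : nat -> R.

(** Being nonincreasing and bounded below, [G] converges, so its successive differences, which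
    dominate [e], vanish. *)
Lemma decrement_cvg0 G e (m : R) :
  (forall n, 0 <= e n) -> (forall n, G n.+1 <= G n - e n) ->
  (forall n, m <= G n) -> e @ \oo --> 0.
Proof.
move=> e0 Ge mG.
have cG : cvgn G.
  apply: nonincreasing_is_cvgn.
    apply/nonincreasing_seqP => n; have := e0 n; have := Ge n; lra.
  by exists m => _ [n _ <-].
have c0 : (fun n => G n - G n.+1) @ \oo --> 0.
  rewrite -(subrr (limn G)); apply: cvgB => //.
  by rewrite cvg_shiftS.
apply: (squeeze_cvgr _ (cvg_cst 0) c0).
by near=> n; rewrite e0 /=; have := Ge n; lra.
Unshelve. all: by end_near.
Qed.

Lemma stepsize_ratio lam xi (m : nat) (l mu kappa : R) :
  0 < l -> 0 < mu < kappa -> (forall n, (m <= n)%N -> l <= lam n) ->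
  (forall n, (m <= n)%N -> 0 <= xi n) ->
  (forall n, (m <= n)%N -> lam n.+1 <= lam n + xi n) ->
  (\sum_(m <= n <oo) (xi n)%:E < +oo)%E ->
  \forall n \near \oo, mu * lam n <= kappa * lam n.+1.
Proof.
move=> l0 /andP[mu0 muk] llam xi0 lamxi sxi.
pose e n := lam n + xi n - lam n.+1.
have : e @ \oo --> 0.
  rewrite -(cvg_shiftn m).
  (* Up to the shift by [m], the slack [e] is the decrement of [lam] minus the partial sums of [xi],
     which stays above [l] minus the total sum. *)
  pose S n := \sum_(m <= k < n + m) xi k.
  apply: (decrement_cvg0 (fun n => lam (n + m)%N - S n) _
    (l - fine (\sum_(m <= n <oo) (xi n)%:E))).
  - by move=> n; rewrite subr_ge0 lamxi // leq_addl.
  - move=> n; rewrite /S addSn big_nat_recr /= ?leq_addl // /e; lra.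
  - move=> n; rewrite lerB // ?llam ?leq_addl //.
    have s0 : (0 <= \sum_(m <= n <oo) (xi n)%:E)%E.
      by apply: nneseries_ge0 => k mk _; rewrite lee_fin xi0.
    rewrite -lee_fin fineK ?ge0_fin_numE// /S -sumEFin.
    by apply: nneseries_lim_ge => k mk _; rewrite lee_fin xi0.
(* Chosen so that [mu * eps = (kappa - mu) * l], which is at most [(kappa - mu) * lam n.+1]. *)
pose eps := (kappa - mu) * l / mu.
have eps0 : 0 < eps by rewrite divr_gt0 // mulr_gt0 // subr_gt0.
move/cvgr0Pnorm_le => /(_ eps eps0) he.
near=> n; have mn : (m <= n)%N by near: n; exact: nbhs_infty_ge.
have : e n <= eps by apply: le_trans (ler_norm _) _; near: n.
rewrite /e => h.
have : mu * (lam n - lam n.+1) <= (kappa - mu) * l.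
  by rewrite mulrC -ler_pdivlMr // -/eps; have := xi0 n mn; lra.
have km0 : 0 <= kappa - mu by rewrite subr_ge0 ltW.
by have := ler_wpM2l km0 (llam n.+1 (leqW mn)); lra.
Unshelve. all: by end_near.
Qed.

(* As [tau n <= t < 1], the upper bound on the Lyapunov function [G] bounds [a],
   which in turn bounds [G] from below. *)
Lemma inertial_cvg0 a D q tau (t K K' : R) :
  (forall n, 0 <= a n) -> (forall n, 0 <= D n) -> (forall n, 0 <= q n) ->
  (forall n, 0 <= tau n <= t) -> (forall n, tau n <= tau n.+1) -> t < 1 ->
  0 <= K < K' ->
  (forall n, a n.+2 <= a n.+1 + tau n * (a n.+1 - a n)
                       + K * D n - K' * D n.+1 - q n) ->
  D @ \oo --> 0 /\ q @ \oo --> 0.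
Proof.
move=> a0 D0 q0 tau0 taui t1 /andP[K0 KK'] rec.
pose G n := a n.+1 - tau n * a n + K * D n.
have e0 n : 0 <= (K' - K) * D n.+1 + q n.
  by rewrite addr_ge0 // mulr_ge0 // subr_ge0 ltW.
(* Monotonicity of [tau] enters here: it lets [tau n.+1] replace [tau n] in front of [a n.+1]. *)
have Ge n : G n.+1 <= G n - ((K' - K) * D n.+1 + q n).
  by rewrite /G; have := rec n; have := ler_wpM2r (a0 n.+1) (taui n); lra.
have G0 n : G n <= `|G 0%N|.
  elim: n => [|n IH]; first exact: ler_norm.
  by have := Ge n; have := e0 n; lra.
have t0 : 0 <= t by case/andP: (tau0 0%N); exact: le_trans.
(* A bound preserved by the recursion: if [a n <= M], then [a n.+1 <= G n + t * a n <= (1 - t) * M +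
   t * M]. *)
pose M := Num.max (a 0%N) (`|G 0%N| / (1 - t)).
have GM : `|G 0%N| <= (1 - t) * M.
  by rewrite mulrC -ler_pdivrMr ?subr_gt0 // le_max lexx orbT.
have taua n : tau n * a n <= t * a n.
  by case/andP: (tau0 n) => _ h; rewrite ler_wpM2r.
have aM n : a n <= M.
  elim: n => [|n IH]; first by rewrite le_max lexx.
  have := G0 n; rewrite {1}/G; have := mulr_ge0 K0 (D0 n).
  by have := taua n; have := ler_wpM2l t0 IH; lra.
have eC : (fun n => (K' - K) * D n.+1 + q n) @ \oo --> 0.
  apply: (decrement_cvg0 _ _ (- (t * M)) e0 Ge) => n.
  have := a0 n.+1; have := mulr_ge0 K0 (D0 n).
  by rewrite /G; have := taua n; have := ler_wpM2l t0 (aM n); lra.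
split.
  rewrite -cvg_shiftS.
  have eC' : (fun n => (K' - K)^-1 * ((K' - K) * D n.+1 + q n)) @ \oo --> 0.
    by rewrite -(mulr0 (K' - K)^-1); apply: cvgMr.
  apply: (squeeze_cvgr _ (cvg_cst 0) eC').
  near=> n; rewrite D0 /= mulrC ler_pdivlMr ?subr_gt0 // mulrC.
  by rewrite lerDl.
apply: (squeeze_cvgr _ (cvg_cst 0) eC).
by near=> n; rewrite q0 lerDr mulr_ge0 // subr_ge0 ltW.
Unshelve. all: by end_near.
Qed.
End RealSequences.

(** * Hilbert space identities and one-step estimates *)

Section Hilbert.
Context {R : realType} {H : completeNormedModType R}.
Variables (ip : {dot H for idfun}) (ip_norm : induces_norm ip).
Implicit Types a b : H.

Let ipC a b : ip a b = ip b a.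
Proof. by rewrite hermC expr0 mul1r. Qed.

Let ipZr (t : R) a b : ip a (t *: b) = t * ip a b.
Proof. exact: linearZr_LR. Qed.

Lemma normD_sqr a b : `|a + b| ^+ 2 = `|a| ^+ 2 + 2 * ip a b + `|b| ^+ 2.
Proof. by rewrite !ip_norm linearDl !linearDr /= (ipC b a); ring. Qed.

Lemma normZ_sqr (t : R) a : `|t *: a| ^+ 2 = t ^+ 2 * `|a| ^+ 2.
Proof. by rewrite normrZ exprMn real_normK // num_real. Qed.

Lemma normB_sqr a b : `|a - b| ^+ 2 = `|a| ^+ 2 - 2 * ip a b + `|b| ^+ 2.
Proof. by rewrite normD_sqr normrN linearNr; ring. Qed.

(** Squaring the triangle inequality suffices, since the norm is induced by [ip]. *)
Lemma Cauchy_Schwarz a b : ip a b <= `|a| * `|b|.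
Proof.
have : `|a + b| ^+ 2 <= (`|a| + `|b|) ^+ 2.
  by rewrite ler_sqr ?nnegrE ?addr_ge0 // ler_normD.
by rewrite normD_sqr; lra.
Qed.

Lemma norm_affine_sqr (t : R) a b :
  `|(1 - t) *: a + t *: b| ^+ 2
  = (1 - t) * `|a| ^+ 2 + t * `|b| ^+ 2 - t * (1 - t) * `|a - b| ^+ 2.
Proof.
rewrite normB_sqr normD_sqr !normZ_sqr ipZr ipC ipZr (ipC b a).
by ring.
Qed.

Lemma norm_extrapolation_sqr (t : R) (x x' p : H) :
  `|x + t *: (x - x') - p| ^+ 2
  = (1 + t) * `|x - p| ^+ 2 - t * `|x' - p| ^+ 2 + t * (1 + t) * `|x - x'| ^+ 2.
Proof.
have -> : x + t *: (x - x') - p = (1 - (- t)) *: (x - p) + (- t) *: (x' - p).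
  rewrite opprK scaleNr scalerDl scale1r -[RHS]addrA -scalerBr.
  by rewrite opprB addrA subrK addrAC.
rewrite norm_affine_sqr opprB addrA subrK.
by ring.
Qed.

(** The relaxed projection step from [w] along [d]. Since [ip (w - y) d >= (1 - kappa) * |w - y|^2]
    and [|d| <= (1 + kappa) * |w - y|], the step length [eta] is at least [c]. The lower bound [m]
    on [ip d (y - p)] yields the additional decrease. *)
Lemma projection_step (kappa gamma m : R) (w y p d v : H) :
  0 < kappa < 1 -> 0 < gamma < 2 -> 0 <= m -> y <> w ->
  d = w - y - v -> `|v| <= kappa * `|w - y| -> m <= ip d (y - p) ->
  let c := (1 - kappa) / (1 + kappa) ^+ 2 in
  d != 0 /\
  `|w - (gamma * (ip (w - y) d / `|d| ^+ 2)) *: d - p| ^+ 2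
  <= `|w - p| ^+ 2 - gamma * (2 - gamma) * (c * (1 - kappa) * `|w - y| ^+ 2)
     - 2 * gamma * (c * m).
Proof.
move=> /andP[k0 k1] /andP[g0 g2] m0 yw dE vle md c.
set s := `|w - y| in vle *.
have s0 : 0 < s by rewrite normr_gt0 subr_eq0; apply/eqP => /esym.
have ile : (1 - kappa) * s ^+ 2 <= ip (w - y) d.
  rewrite dE linearBr /= -ip_norm -/s.
  have := Cauchy_Schwarz (w - y) v; rewrite -/s.
  by have := ler_wpM2l (ltW s0) vle; lra.
have i0 : 0 < ip (w - y) d.
  by apply: lt_le_trans ile; rewrite mulr_gt0 ?exprn_gt0 // subr_gt0.
have d0 : d != 0 by apply: contraTneq i0 => ->; rewrite linear0r ltxx.
split=> //.
have nd0 : 0 < `|d| ^+ 2 by rewrite exprn_gt0 // normr_gt0.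
have dle : `|d| ^+ 2 <= (1 + kappa) ^+ 2 * s ^+ 2.
  rewrite -exprMn ler_sqr ?nnegrE ?mulr_ge0 ?addr_ge0 ?(ltW k0) ?(ltW s0) //.
  by rewrite dE mulrDl mul1r (le_trans (ler_normB _ _)) // lerD2l.
have c0 : 0 < c.
  by apply: divr_gt0; rewrite ?subr_gt0 // exprn_gt0 // addr_gt0.
set eta := _ / `|d| ^+ 2.
have etad : eta * `|d| ^+ 2 = ip (w - y) d by rewrite divfK // gt_eqF.
have ceta : c <= eta.
  rewrite ler_pdivlMr //; apply: le_trans ile.
  apply: le_trans (ler_wpM2l (ltW c0) dle) _.
  by rewrite mulrA divfK // expf_neq0 // gt_eqF // addr_gt0.
rewrite [w - _ - p]addrAC [`|_ - p - _| ^+ 2]normB_sqr normZ_sqr ipZr (ipC (w - p)).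
have -> : w - p = (w - y) + (y - p) by rewrite addrA subrK.
rewrite linearDr /= (ipC d (w - y)).
(* The quadratic term becomes a multiple of [eta * ip (w - y) d]; with the cross term it leaves the
   factor [- gamma * (2 - gamma)]. *)
have -> : (gamma * eta) ^+ 2 * `|d| ^+ 2 = gamma ^+ 2 * (eta * ip (w - y) d).
  by rewrite -etad; ring.
have h1 : c * (1 - kappa) * s ^+ 2 <= eta * ip (w - y) d.
  rewrite -mulrA ler_pM ?(ltW c0) // mulr_ge0 ?sqr_ge0 // subr_ge0.
  exact: ltW.
have h2 : c * m <= eta * ip d (y - p) by rewrite ler_pM ?(ltW c0).
have h3 : 0 <= gamma * (2 - gamma) by rewrite mulr_ge0 ?subr_ge0 ?(ltW g0) ?ltW.
have := ler_wpM2l h3 h1; have := ler_wpM2l (ltW g0) h2; lra.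
Qed.

(** Expand [x2 - p] as a convex combination of [z - p] and [u - p], and these through the
    extrapolations. The negative term in [|z - u|^2] supplies [|x2 - x1|^2], because
    [alpha *: (u - z)] is [(x2 - x1) - beta *: (x1 - x0)]. *)
Lemma inertial_step (alpha beta theta Q : R) (x0 x1 x2 z w u p : H) :
  0 < alpha < 1 -> 0 <= beta -> 0 <= theta <= 1 ->
  z = x1 + beta *: (x1 - x0) -> w = x1 + theta *: (x1 - x0) ->
  x2 = (1 - alpha) *: z + alpha *: u ->
  `|u - p| ^+ 2 <= `|w - p| ^+ 2 - Q ->
  `|x2 - p| ^+ 2 <= `|x1 - p| ^+ 2
    + ((1 - alpha) * beta + alpha * theta) * (`|x1 - p| ^+ 2 - `|x0 - p| ^+ 2)
    + ((1 - alpha) * beta * (1 + beta) + 2 * alpha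
       + (1 - alpha) / alpha * beta * (1 - beta)) * `|x1 - x0| ^+ 2
    - (1 - alpha) / alpha * (1 - beta) * `|x2 - x1| ^+ 2 - alpha * Q.
Proof.
move=> /andP[a0 a1] b0 /andP[t0 t1] zE wE x2E uQ.
have x2p : x2 - p = (1 - alpha) *: (z - p) + alpha *: (u - p).
  rewrite x2E !scalerBr addrACA -opprD -scalerDl subrK scale1r //.
have x2z : `|(x2 - x1) - beta *: (x1 - x0)| ^+ 2 = alpha ^+ 2 * `|z - u| ^+ 2.
  have -> : x2 - x1 - beta *: (x1 - x0) = alpha *: (u - z).
    rewrite -addrA -opprD -zE x2E scalerBl scale1r scalerBr.
    by rewrite addrAC [z - _ - z]addrAC subrr add0r addrC.
  by rewrite normZ_sqr distrC.
have x2ps : `|x2 - p| ^+ 2 = (1 - alpha) * `|z - p| ^+ 2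
    + alpha * `|u - p| ^+ 2 - (1 - alpha) / alpha * (alpha ^+ 2 * `|z - u| ^+ 2).
  rewrite x2p norm_affine_sqr opprB addrA subrK.
  by field; rewrite gt_eqF.
have zps := norm_extrapolation_sqr beta x1 x0 p; rewrite -zE in zps.
have wps := norm_extrapolation_sqr theta x1 x0 p; rewrite -wE in wps.
(* The cross term is absorbed using [0 <= beta * |(x2 - x1) - (x1 - x0)|^2]. *)
have zle : (1 - beta) * `|x2 - x1| ^+ 2 - beta * (1 - beta) * `|x1 - x0| ^+ 2
    <= alpha ^+ 2 * `|z - u| ^+ 2.
  rewrite -x2z [leRHS]normB_sqr normZ_sqr ipZr.
  have := mulr_ge0 b0 (sqr_ge0 `|x2 - x1 - (x1 - x0)|).
  by rewrite [`|_ - (x1 - x0)| ^+ 2]normB_sqr; lra.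
have aa0 : 0 <= (1 - alpha) / alpha.
  by rewrite divr_ge0 ?subr_ge0 ?(ltW a0) ?(ltW a1).
have h1 := ler_wpM2l aa0 zle.
have h2 := ler_wpM2l (ltW a0) uQ.
(* Bounding [theta * (1 + theta)] by 2 makes the coefficient of [|x1 - x0|^2] independent of the
   iteration. *)
have h3 : alpha * (theta * (1 + theta)) * `|x1 - x0| ^+ 2
    <= 2 * alpha * `|x1 - x0| ^+ 2.
  rewrite ler_wpM2r ?sqr_ge0 // [2 * _]mulrC ler_wpM2l ?(ltW a0) //.
  by nra.
rewrite x2ps zps; rewrite wps in h2.
move: h1 h2 h3; set r := (1 - alpha) / alpha; lra.
Qed.

End Hilbert.

(** * Zeros of the sum, the resolvent step, step sizes and parameters *)

Section Algorithm.
Context {R : realType} {H : completeNormedModType R}.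
Variables (ip : {dot H for idfun}) (ip_norm : induces_norm ip).
Variables (A : H -> set H) (B : H -> H).
Hypothesis monB : monotone_op ip (fun x => [set B x]).
Variables (nu : R) (nu_gt0 : 0 < nu) (strongA : strongly_monotone ip nu A).

Lemma zeros_sumP (p : H) : zeros_sum A B p <-> A p (- B p).
Proof.
split=> [[a Aa /eqP]|Ap]; first by rewrite addr_eq0 => /eqP <-.
by exists (- B p) => //; rewrite addNr.
Qed.

Lemma zeros_sum_unique (p p' : H) :
  zeros_sum A B p -> zeros_sum A B p' -> p' = p.
Proof.
move=> /zeros_sumP Ap /zeros_sumP Ap'.
have := strongA _ _ _ _ Ap' Ap.
have := monB p' p _ _ erefl erefl.
rewrite -opprD linearNl /= => Bge Ale.
have : `|p' - p| ^+ 2 <= 0.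
  rewrite -(pmulr_rle0 _ nu_gt0); apply: le_trans Ale _.
  by rewrite oppr_le0.
rewrite exprn_even_le0 //= normr_eq0 subr_eq0.
by move/eqP.
Qed.

(** The resolvent provides [v] in [A y] for which the left argument of [ip] is
    [lam *: ((v + B p) + (B y - B p))]. Strong monotonicity of [A] handles the first summand, as
    [- B p] lies in [A p], and monotonicity of [B] the second. *)
Lemma resolvent_step_ge (lam : R) (w y p : H) :
  0 < lam -> zeros_sum A B p -> resolvent A lam (w - lam *: B w) y ->
  lam * nu * `|y - p| ^+ 2 <= ip (w - y - lam *: (B w - B y)) (y - p).
Proof.
move=> lam0 /zeros_sumP Ap [v Av vE].
have -> : w - y - lam *: (B w - B y) = lam *: ((v + B p) + (B y - B p)).
  rewrite addrACA subrr addr0 [RHS]scalerDr.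
  have -> : lam *: v = w - lam *: B w - y by rewrite -vE addrAC subrr add0r.
  by rewrite scalerBr opprB [lam *: B y - _]addrC addrA [w - y - _]addrAC.
rewrite (linearZl_LR ip) /= -mulrA ler_pM2l // linearDl /=.
apply: le_trans (strongA _ _ _ _ Av Ap) _.
by rewrite opprK lerDl; exact: monB.
Qed.

End Algorithm.

(** By induction: the Lipschitz bound keeps the quotient in the update at least [mu / L], and adding
    [xi n] never decreases the step size. *)
Lemma stepsize_lbound (R : realType) (H : completeNormedModType R)
    (B : H -> H) (L mu : R) (w y : nat -> H) (lambda xi : nat -> R) :
  0 < L -> L.-lipschitz B -> 0 < mu -> (forall n, (1 <= n)%N -> 0 <= xi n) ->
  (forall n, (1 <= n)%N -> lambda n.+1 =
      if B (w n) != B (y n)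
      then Num.min (mu * `|w n - y n| / `|B (w n) - B (y n)|) (lambda n + xi n)
      else lambda n + xi n) ->
  forall n, (1 <= n)%N -> Num.min (lambda 1%N) (mu / L) <= lambda n.
Proof.
move=> L0 lipB mu0 xi0 lamE; elim=> // -[|n] IH _; first by rewrite ge_min lexx.
rewrite (lamE n.+1) //.
have h : Num.min (lambda 1%N) (mu / L) <= lambda n.+1 + xi n.+1.
  by apply: (le_trans (IH _)) => //; rewrite lerDl xi0.
case: ifPn => // Bwy; rewrite le_min h andbT.
rewrite ge_min; apply/orP; right.
have := lipB (w n.+1, y n.+1) (conj I I); rewrite /= => lip.
rewrite ler_pdivlMr ?normr_gt0 ?subr_eq0 //.
rewrite mulrAC ler_pdivrMr // -mulrA ler_wpM2l ?(ltW mu0) //.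
by rewrite mulrC.
Qed.

Lemma inertial_gain (R : realType) (alpha beta : R) :
  0 < alpha < 1 / 3 -> 0 <= beta < (1 - 3 * alpha) / (3 * (1 - alpha)) ->
  [/\ beta < 1, (1 - alpha) * beta + alpha < 1 &
   0 <= (1 - alpha) * beta * (1 + beta) + 2 * alpha
        + (1 - alpha) / alpha * beta * (1 - beta)
     < (1 - alpha) / alpha * (1 - beta)].
Proof.
move=> /andP[a0 a3] /andP[b0]; rewrite ltr_pdivlMr; last lra.
move=> bE.
have b3 : beta < 1 / 3.
  rewrite ltNge; apply/negP => b3.
  have : 0 <= (beta - 1 / 3) * (1 - alpha) by apply: mulr_ge0; lra.
  by lra.
have rb : 2 < (1 - alpha) / alpha * (1 - beta).
  by rewrite mulrAC ltr_pdivlMr //; lra.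
split; [lra|lra|].
have r0 : 0 <= (1 - alpha) / alpha by apply: divr_ge0; lra.
move: rb r0; set r := (1 - alpha) / alpha => rb r0.
set s := (1 - alpha) * beta.
have s0 : 0 <= s by apply: mulr_ge0; lra.
have s3 : s < 1 / 3 by rewrite /s; lra.
(* The upper bound amounts to [s * (1 + beta) + 2 * alpha < r * (1 - beta)^2]: the left side is
   below 4/9 + 2/3, the right side above [2 * (1 - beta) > 4/3]. *)
apply/andP; split; last by nra.
have h1 : 0 <= s * (1 + beta) by apply: mulr_ge0; lra.
have h2 : 0 <= r * beta * (1 - beta) by apply: mulr_ge0; [exact: mulr_ge0|lra].
by lra.
Qed.

(** * Strong convergence of the iterates *)

Theorem theorem11 (R : realType) (H : completeNormedModType R)
    (ip : {dot H for idfun}) (ip_norm : induces_norm ip)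
    (A : H -> set H) (maxA : maximal_monotone ip A)
    (B : H -> H) (monB : monotone_op ip (fun x => [set B x]))
    (L : R) (L_gt0 : 0 < L) (lipB : L.-lipschitz B)
    (Omega_neq0 : zeros_sum A B !=set0)
    (alpha : R) (alpha_range : 0 < alpha < 1 / 3)
    (beta : R) (beta_range : 0 <= beta < (1 - 3 * alpha) / (3 * (1 - alpha)))
    (theta : nat -> R)
    (theta_range : forall n, (1 <= n)%N ->
       [/\ 0 <= theta n, theta n <= theta n.+1 & theta n.+1 <= 1])
    (nu : R) (nu_gt0 : 0 < nu) (strongA : strongly_monotone ip nu A)
    (mu gamma : R) (xi : nat -> R)
    (x z w y d u : nat -> H) (eta lambda : nat -> R)
    (run : IPCMAS1_run ip A B alpha beta mu gamma theta xi
             x z w y d u eta lambda) :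
  exists p : H, zeros_sum A B = [set p] /\ x @ \oo --> p.
Proof.
have [p Op] := Omega_neq0; exists p; split.
  apply/seteqP; split=> [p' Op'|_ ->] //.
  exact: (zeros_sum_unique _ _ _ monB _ nu_gt0 strongA).
case: run => /andP[mu0 mu1] g2 lam1 xi0 sxi zE wE yE yw dE etaE uE xE lamE.
pose l := Num.min (lambda 1%N) (mu / L).
have l0 : 0 < l by rewrite lt_min lam1 divr_gt0.
have llam : forall n, (1 <= n)%N -> l <= lambda n.
  exact: (stepsize_lbound _ _ _ _ _ _ _ _ _ L_gt0 lipB mu0 xi0 lamE).
(* Any value strictly between [mu] and 1 would do. *)
pose kappa := (1 + mu) / 2.
have k1 : 0 < kappa < 1 by rewrite /kappa; lra.
have muk : 0 < mu < kappa by rewrite /kappa; lra.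
have lamxi n : (1 <= n)%N -> lambda n.+1 <= lambda n + xi n.
  by move=> n1; rewrite lamE //; case: ifP => // _; rewrite ge_min lexx orbT.
have [M _ hM] := stepsize_ratio _ _ _ _ _ _ l0 muk llam xi0 lamxi sxi.
have vle n : (1 <= n)%N -> (M <= n)%N ->
    `|lambda n *: (B (w n) - B (y n))| <= kappa * `|w n - y n|.
  move=> n1 Mn; have ln0 := lt_le_trans l0 (llam n n1).
  (* After multiplying by [mu], [mu * lambda n] is replaced by [kappa * lambda n.+1], to which the
     update rule applies. *)
  rewrite normrZ (gtr0_norm ln0) -(ler_pM2l mu0) mulrA.
  apply: le_trans (ler_wpM2r (normr_ge0 _) (hM n Mn)) _.
  rewrite -mulrA [leRHS]mulrCA ler_wpM2l //; first by case/andP: k1 => /ltW.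
  have [BE|Bn] := eqVneq (B (w n)) (B (y n)).
    by rewrite BE subrr normr0 mulr0 mulr_ge0 // ltW.
  have BP : 0 < `|B (w n) - B (y n)| by rewrite normr_gt0 subr_eq0.
  rewrite -ler_pdivlMr // (lamE n) // Bn.
  by rewrite ge_min lexx.
pose c := (1 - kappa) / (1 + kappa) ^+ 2.
have c0 : 0 < c.
  by case/andP: k1 => k0 k1; apply: divr_gt0; [lra|apply: exprn_gt0; lra].
have [g0 g1] := andP g2.
(* One constant for both gains, uniform in [n] because [l] bounds [lambda n] from below. *)
pose c' := Num.min (gamma * (2 - gamma) * (c * (1 - kappa)))
                   (2 * gamma * (c * (l * nu))).
have c'0 : 0 < c'.
  case/andP: k1 => k0 k1.
  rewrite lt_min (mulr_gt0 (mulr_gt0 g0 _) (mulr_gt0 c0 _)) ?subr_gt0 //=.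
  exact: mulr_gt0 (mulr_gt0 _ g0) (mulr_gt0 c0 (mulr_gt0 l0 nu_gt0)).
have ustep n : (1 <= n)%N -> (M <= n)%N ->
    `|u n - p| ^+ 2 <= `|w n - p| ^+ 2
       - c' * (`|w n - y n| ^+ 2 + `|y n - p| ^+ 2).
  move=> n1 Mn; have ln0 := lt_le_trans l0 (llam n n1).
  have m0 : 0 <= l * nu * `|y n - p| ^+ 2.
    by rewrite mulr_ge0 ?sqr_ge0 // mulr_ge0 ?(ltW l0) ?(ltW nu_gt0).
  have md : l * nu * `|y n - p| ^+ 2 <= ip (d n) (y n - p).
    rewrite dE //.
    apply: le_trans
      (resolvent_step_ge _ _ _ monB _ strongA _ _ _ _ ln0 Op (yE n n1)).
    by rewrite ler_wpM2r ?sqr_ge0 // ler_wpM2r ?(ltW nu_gt0) // llam.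
  have [d0] := projection_step _ ip_norm _ _ _ _ _ _ _ _ k1 g2 m0 (yw n n1)
    (dE n n1) (vle n n1 Mn) md.
  rewrite uE // etaE // d0 => h; apply: le_trans h _.
  rewrite -/c -addrA lerD2l -opprD lerN2 mulrDr.
  have cl : c' <= gamma * (2 - gamma) * (c * (1 - kappa)).
    by rewrite ge_min lexx.
  have cr : c' <= 2 * gamma * (c * (l * nu)) by rewrite ge_min lexx orbT.
  have := ler_wpM2r (sqr_ge0 `|w n - y n|) cl.
  by have := ler_wpM2r (sqr_ge0 `|y n - p|) cr; lra.
have [b1 t1 Kle] := inertial_gain _ _ _ alpha_range beta_range.
have /andP[b0 _] := beta_range.
have a01 : 0 < alpha < 1 by move: alpha_range; lra.
have [a0 a1] := andP a01.
have theta01 n : (1 <= n)%N -> 0 <= theta n <= 1.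
  move=> n1; have [h1 h2 h3] := theta_range n n1.
  by rewrite h1 (le_trans h2 h3).
(* The index [(n + M).+1] is both positive and at least [M], so the rules of the run and the descent
   estimate all apply. *)
pose D n := `|x (n + M).+1 - x (n + M)%N| ^+ 2.
pose q n := alpha * (c' * (`|w (n + M).+1 - y (n + M).+1| ^+ 2
                     + `|y (n + M).+1 - p| ^+ 2)).
have [cD cq] : D @ \oo --> 0 /\ q @ \oo --> 0.
  apply: (inertial_cvg0 (fun n => `|x (n + M)%N - p| ^+ 2) D q
    (fun n => (1 - alpha) * beta + alpha * theta (n + M).+1) _ _ _
    _ _ _ _ _ t1 Kle).
  - by move=> n; exact: sqr_ge0.
  - by move=> n; exact: sqr_ge0.
  - move=> n; apply: mulr_ge0 (ltW a0) (mulr_ge0 (ltW c'0) _).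
    exact: addr_ge0 (sqr_ge0 _) (sqr_ge0 _).
  - move=> n; have /andP[h0 h1] := theta01 (n + M).+1 isT.
    have ab : 0 <= (1 - alpha) * beta by rewrite mulr_ge0 // subr_ge0 ltW.
    have at0 : 0 <= alpha * theta (n + M).+1 by rewrite mulr_ge0 // ltW.
    apply/andP; split; [exact: addr_ge0|rewrite lerD2l].
    by rewrite -[leRHS]mulr1 ler_wpM2l ?(ltW a0).
  - move=> n; have [_ h _] := theta_range (n + M).+1 isT.
    by rewrite lerD2l ler_wpM2l ?(ltW a0).
  - move=> n.
    apply: (inertial_step _ ip_norm _ _ _ _ _ _ _ _ _ _ _ a01 b0
      (theta01 (n + M).+1 isT) (zE (n + M).+1 isT) (wE (n + M).+1 isT)
      (xE (n + M).+1 isT) (ustep (n + M).+1 isT _)).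
    by rewrite leqW // leq_addl.
apply/subr_cvg0/norm_cvg0P; rewrite -cvg_shiftS -(cvg_shiftn M).
(* This majorant comes from the path [x k], [w k], [y k], [p] with [k = (n + M).+1]: the first leg
   is controlled by [D n] as [theta k <= 1], the other two by [q n]. *)
have c0' : (fun n => Num.sqrt (D n) + 2 * Num.sqrt ((alpha * c')^-1 * q n))
    @ \oo --> 0.
  have sqrt0 (f : nat -> R) :
      f @ \oo --> 0 -> Num.sqrt (f n) @[n --> \oo] --> 0.
    move=> cf; rewrite -(sqrtr0 R); apply: continuous_cvg => //.
    exact: sqrt_continuous.
  rewrite -(addr0 0) -[X in _ + X](mulr0 2); apply: cvgD; first exact: sqrt0.
  apply: cvgMr; apply: sqrt0.
  by rewrite -(mulr0 (alpha * c')^-1); apply: cvgMr.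
apply: (squeeze_cvgr _ (cvg_cst 0) c0').
near=> n; rewrite normr_ge0 /=.
set k := (n + M).+1.
have sqrt_norm (a b : R) : 0 <= a -> a ^+ 2 <= b -> a <= Num.sqrt b.
  by move=> a0' ab; rewrite -(ger0_norm a0') -sqrtr_sqr ler_wsqrtr.
have qE : (alpha * c')^-1 * q n = `|w k - y k| ^+ 2 + `|y k - p| ^+ 2.
  by rewrite /q (mulrA alpha) mulKf // mulf_neq0 // gt_eqF.
have h1 : `|w k - y k| <= Num.sqrt ((alpha * c')^-1 * q n).
  by rewrite qE sqrt_norm // lerDl sqr_ge0.
have h2 : `|y k - p| <= Num.sqrt ((alpha * c')^-1 * q n).
  by rewrite qE sqrt_norm // lerDr sqr_ge0.
have h3 : `|x k - w k| <= Num.sqrt (D n).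
  rewrite sqrt_norm // ler_sqr ?nnegrE //.
  have /andP[h0 h1'] := theta01 k isT.
  rewrite wE // opprD addNKr normrN normrZ ger0_norm //.
  by rewrite -[leRHS]mul1r ler_wpM2r.
have := ler_distD (w k) (x k) p; have := ler_distD (y k) (w k) p.
lra.
Unshelve. all: by end_near.
Qed.
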